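(* The action of $\mathfrak{S}_4$ on $F_4$ is homotopically trivial, i.e. each $\sigma\in\mathfrak{S}_4$ acts on $F_4$ by a map homotopic to the identity. In particular, $H^*(F_4;\mathbb{Q})\cong H^*(\mathrm{PGL}_3(\mathbb{C});\mathbb{Q})$ is trivial as an $\mathfrak{S}_4$-representation.
   Context: $F_4\subset(\mathbb{CP}^2)^4$ is the space of ordered $4$-tuples of distinct points of $\mathbb{CP}^2$, no three of which lie on a line. $\mathfrak{S}_4$ acts on $F_4$ by permuting coordinates, and $\mathrm{PGL}_3(\mathbb{C})$ acts on $F_4$ diagonally. The isomorphism $H^*(F_4;\mathbb{Q})\cong H^*(\mathrm{PGL}_3(\mathbb{C});\mathbb{Q})$ is induced by the orbit map $\mathrm{PGL}_3(\mathbb{C})\to F_4$, $g\mapsto g\cdot x$, for a basepoint $x\in F_4$, which is a homeomorphism. *)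

(* Defs.v *)
From HB Require Import structures.
From mathcomp Require Import all_boot all_order all_algebra all_fingroup.
From mathcomp Require Import generic_quotient ring_quotient.
From mathcomp Require Import all_classical reals topology normedtype.
From mathcomp.real_closed Require Import complex.

Set Implicit Arguments.
Unset Strict Implicit.
Unset Printing Implicit Defensive.

Import Order.TTheory GRing.Theory Num.Theory.
Import numFieldNormedType.Exports.

Local Open Scope classical_set_scope.
Local Open Scope ring_scope.
Local Open Scope quotient_scope.

Lemma continuous_mx (X T : topologicalType) m n (f : X -> 'M[T]_(m, n)) :
  (forall i j, continuous (fun x => f x i j)) -> continuous f.
Proof.
move=> cf x U [P HP PU].
have H : forall ij : 'I_m * 'I_n,
    \forall y \near x, P ij.1 ij.2 (f y ij.1 ij.2).
  by move=> [i j]; apply: cf; exact: HP.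
have := filter_forall _ H => /(_ _) G.
apply: filterS G => y Hy; apply: PU => i j; exact: (Hy (i, j)).
Qed.

Lemma mx_coord_continuous (T : topologicalType) m n i j :
  continuous (fun M : 'M[T]_(m, n) => M i j).
Proof.
move=> M U nU.
exists (fun i' j' => if (i' == i) && (j' == j) then U else setT).
  move=> i' j'; case: ifPn => [/andP[/eqP-> /eqP->]//|_]; exact: filterT.
by move=> N /(_ i j); rewrite !eqxx.
Qed.

Lemma set_val_continuous (X : topologicalType) (A : set X) :
  continuous (set_val : A -> X).
Proof. exact: initial_continuous. Qed.

Lemma continuous_to_set (X Y : topologicalType) (A : set Y) (f : X -> A) :
  continuous (set_val \o f) -> continuous f.
Proof.
move=> /continuousP cf; apply/continuousP => _ [B oB <-].
exact: cf.
Qed.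

Lemma continuous_to_ptws (X Y : topologicalType) (I : Type)
    (f : X -> {ptws I -> Y}) :
  (forall i, continuous (fun x => f x i)) -> continuous f.
Proof.
move=> cf x; apply/cvg_sup => i; apply/cvg_image => //.
  by apply/seteqP; split => // y _; exists (fun=> y).
move=> U /= nU; exists ((fun p : {ptws I -> Y} => p i) @^-1` U).
  exact: (cf i x).
apply/seteqP; split => [y [p Up <-]//|y Uy]; by exists (fun=> y).
Qed.

Lemma ptws_continuous (Y : topologicalType) (I : eqType) i :
  continuous (fun p : {ptws I -> Y} => p i).
Proof. exact: (@proj_continuous I (fun=> Y) i). Qed.

Lemma continuous_mulr_sum (K : numFieldType) (X : topologicalType) n
    (f : 'I_n -> X -> K) (c : 'I_n -> K) :
  (forall j, continuous (f j)) -> continuous (fun x => \sum_j f j x * c j).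
Proof.
move=> cf x; apply: cvg_big => [|j _]; first exact: add_continuous.
by apply: cvgMr_tmp; exact: cf.
Qed.

Definition std_simplex (R : realType) n : set 'rV[R]_n.+1 :=
  [set t | (forall i, 0 <= t 0 i) /\ \sum_i t 0 i = 1].
Arguments std_simplex : clear implicits.

Section Face.
Variables (R : realType) (n : nat) (i : 'I_n.+2).

Definition face_row (t : 'rV[R]_n.+1) : 'rV[R]_n.+2 :=
  \row_j (if unlift i j is Some k then t 0 k else 0).

Lemma face_row_subproof (t : std_simplex R n) :
  face_row (val t) \in std_simplex R n.+1.
Proof.
have [t0 t1] := set_valP t; apply/mem_set; split => [j|].
  by rewrite mxE; case: unliftP.
rewrite (bigD1_ord i) //= mxE unlift_none add0r -[RHS]t1.
by apply: eq_bigr => k _; rewrite mxE liftK.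
Qed.

Definition face_fun (t : std_simplex R n) : std_simplex R n.+1 :=
  SigSub (face_row_subproof t).

Lemma face_fun_continuous : continuous face_fun.
Proof.
apply: continuous_to_set; apply: continuous_mx => a j.
rewrite (_ : (fun _ => _) = fun t : std_simplex R n =>
    if unlift i j is Some k then set_val t 0 k else 0); last first.
  by apply/funext => t; rewrite /= set_valE /= mxE.
case: (unlift i j) => [k|]; last exact: cst_continuous.
move=> t; apply: (@continuous_comp _ _ _ set_val (fun M : 'rV[R]_n.+1 => M 0 k)).
  exact: set_val_continuous.
exact: mx_coord_continuous.
Qed.

HB.instance Definition _ :=
  isContinuous.Build _ _ face_fun face_fun_continuous.

End Face.

Section Singular.
Variables (R : realType) (X : topologicalType).

Definition singular_simplex n := continuousType (std_simplex R n) X.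

Definition face n (i : 'I_n.+2) (s : singular_simplex n.+1) :
  singular_simplex n := s \o face_fun i.

(* [rat^o] is the one-dimensional rational vector space; a cochain is given by
   its values on the basis of singular simplices. *)
Definition cochain n := singular_simplex n -> rat^o.

HB.instance Definition _ n := GRing.Lmodule.on (cochain n).

Definition coboundary n (c : cochain n) : cochain n.+1 :=
  fun s => \sum_(i < n.+2) (-1) ^+ i * c (face i s).

Lemma coboundary_is_linear n : linear (@coboundary n).
Proof.
move=> a c d; apply/funext => s.
rewrite -[RHS]/(a * coboundary c s + coboundary d s) mulr_sumr -big_split /=.
apply: eq_bigr => i _; rewrite mulrCA -mulrDr; congr (_ * _).
Qed.

HB.instance Definition _ n := GRing.isLinear.Build _ _ _ _ (@coboundary n)
  (@coboundary_is_linear n).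

Definition is_cocycle n : {pred cochain n} := [pred c | coboundary c == 0].

Lemma is_cocycle_submod n : submod_closed (@is_cocycle n).
Proof.
split; first by rewrite inE linear0.
move=> a c d /eqP hc /eqP hd; apply/eqP.
by rewrite linearP /= hc hd scaler0 addr0.
Qed.

HB.instance Definition _ n :=
  GRing.isSubmodClosed.Build _ _ (@is_cocycle n) (@is_cocycle_submod n).

Record cocycle n := Cocycle {
  cocycle_val :> cochain n;
  _ : cocycle_val \in @is_cocycle n
}.

HB.instance Definition _ n := [isSub for @cocycle_val n].
HB.instance Definition _ n := [Choice of cocycle n by <:].
HB.instance Definition _ n := [SubChoice_isSubLmodule of cocycle n by <:].

Definition is_coboundary n : cochain n -> Prop :=
  if n is m.+1 then fun c => exists b : cochain m, c = coboundary b
  else fun c => c = 0.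

Definition coboundaries n : {pred cocycle n} :=
  [pred z | `[< is_coboundary (val z) >]].

Lemma coboundaries_submod n : submod_closed (@coboundaries n).
Proof.
split=> [|a y z /asboolP hy /asboolP hz]; apply/asboolP.
  case: n => [|n] //=.
  exists 0; exact/esym/(linear0 (@coboundary n)).
case: n y z hy hz => [|n] y z /=.
  by move=> hy hz; rewrite /= hy hz scaler0 addr0.
move=> [b hb] [c hc]; exists (a *: b + c).
by rewrite linearP /= hb hc.
Qed.

HB.instance Definition _ n :=
  GRing.isSubmodClosed.Build _ _ (@coboundaries n) (@coboundaries_submod n).

Definition cohomology n := ring_quotient.Quotient.quot (@coboundaries n).

HB.instance Definition _ n := GRing.Zmodule.on (cohomology n).

Definition cohomology_class n (z : cocycle n) : cohomology n :=
  \pi_(ring_quotient.Quotient.quot (@coboundaries n)) z.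

Lemma cohomology_classP n (y z : cocycle n) :
  cohomology_class y = cohomology_class z <-> y - z \in @coboundaries n.
Proof.
rewrite ring_quotient.Quotient.idealrBE /cohomology_class.
by split => [->|/eqP].
Qed.

Lemma cohomology_classK n (a : cohomology n) : cohomology_class (repr a) = a.
Proof. exact: reprK. Qed.

Lemma cohomology_classD n :
  {morph @cohomology_class n : y z / y + z >-> y + z}.
Proof. by move=> y z; rewrite /cohomology_class raddfD. Qed.

Definition cohomology_scale n (q : rat) (a : cohomology n) : cohomology n :=
  cohomology_class (q *: repr a).

Lemma cohomology_scale_class n q (z : cocycle n) :
  cohomology_scale q (cohomology_class z) = cohomology_class (q *: z).
Proof.
apply/cohomology_classP; rewrite -scalerBr rpredZ//.
by apply/cohomology_classP; rewrite cohomology_classK.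
Qed.

Lemma cohomology_scaleA n p q (a : cohomology n) :
  cohomology_scale p (cohomology_scale q a) = cohomology_scale (p * q) a.
Proof.
by rewrite -[a]cohomology_classK !cohomology_scale_class scalerA.
Qed.

Lemma cohomology_scale1 n : left_id 1 (@cohomology_scale n).
Proof.
by move=> a; rewrite -[a]cohomology_classK !cohomology_scale_class scale1r.
Qed.

Lemma cohomology_scaleDr n : right_distributive (@cohomology_scale n) +%R.
Proof.
move=> q a b; rewrite -[a]cohomology_classK -[b]cohomology_classK.
by rewrite -cohomology_classD !cohomology_scale_class scalerDr cohomology_classD.
Qed.

Lemma cohomology_scaleDl n (a : cohomology n) :
  {morph (@cohomology_scale n)^~ a : p q / p + q}.
Proof.
move=> p q; rewrite -[a]cohomology_classK !cohomology_scale_class.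
by rewrite scalerDl cohomology_classD.
Qed.

HB.instance Definition _ n := GRing.Zmodule_isLmodule.Build rat (cohomology n)
  (@cohomology_scaleA n) (@cohomology_scale1 n) (@cohomology_scaleDr n)
  (@cohomology_scaleDl n).

Lemma cohomology_class_is_linear n : linear (@cohomology_class n).
Proof.
by move=> q y z; rewrite cohomology_classD -cohomology_scale_class.
Qed.

HB.instance Definition _ n := GRing.isLinear.Build _ _ _ _
  (@cohomology_class n) (@cohomology_class_is_linear n).

End Singular.

Section InducedMap.
Variables (R : realType) (X Y : topologicalType) (f : continuousType X Y).

Definition push_simplex n (s : singular_simplex R X n) :
  singular_simplex R Y n := f \o s.

Definition cochain_map n (c : cochain R Y n) : cochain R X n :=
  c \o @push_simplex n.

Lemma cochain_map_is_linear n : linear (@cochain_map n).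
Proof. by []. Qed.

HB.instance Definition _ n := GRing.isLinear.Build _ _ _ _ (@cochain_map n)
  (@cochain_map_is_linear n).

Lemma coboundary_cochain_map n (c : cochain R Y n) :
  coboundary (cochain_map c) = cochain_map (coboundary c).
Proof.
apply/funext => s; apply: eq_bigr => i _; congr (_ * c _).
exact/continuousEP.
Qed.

Lemma cocycle_map_subproof n (z : cocycle R Y n) :
  cochain_map z \in @is_cocycle R X n.
Proof.
have /eqP hz := valP z; apply/eqP.
by rewrite coboundary_cochain_map hz linear0.
Qed.

Definition cocycle_map n (z : cocycle R Y n) : cocycle R X n :=
  Cocycle (cocycle_map_subproof z).

Lemma cocycle_map_is_linear n : linear (@cocycle_map n).
Proof. by move=> q y z; apply: val_inj. Qed.

HB.instance Definition _ n := GRing.isLinear.Build _ _ _ _ (@cocycle_map n)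
  (@cocycle_map_is_linear n).

Lemma cocycle_map_coboundaries n (z : cocycle R Y n) :
  z \in @coboundaries R Y n -> cocycle_map z \in @coboundaries R X n.
Proof.
move=> /asboolP hz; apply/asboolP; case: n z hz => [|n] z /=.
  by move=> ->; rewrite linear0.
by move=> [b ->]; exists (cochain_map b); rewrite coboundary_cochain_map.
Qed.

Definition cohomology_map n (a : cohomology R Y n) : cohomology R X n :=
  cohomology_class (cocycle_map (repr a)).

Lemma cohomology_map_class n (z : cocycle R Y n) :
  cohomology_map (cohomology_class z) = cohomology_class (cocycle_map z).
Proof.
apply/cohomology_classP; rewrite -linearB; apply: cocycle_map_coboundaries.
by apply/cohomology_classP; rewrite cohomology_classK.
Qed.

Lemma cohomology_map_is_linear n : linear (@cohomology_map n).
Proof.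
move=> q a b; rewrite -[a]cohomology_classK -[b]cohomology_classK.
by rewrite -linearP !cohomology_map_class linearP [LHS]linearP.
Qed.

HB.instance Definition _ n := GRing.isLinear.Build _ _ _ _ (@cohomology_map n)
  (@cohomology_map_is_linear n).

End InducedMap.
Arguments cohomology_map {R X Y} f {n} a.

Definition homotopic (R : realType) (X Y : topologicalType) (f g : X -> Y) :=
  exists H : R * X -> Y,
    [/\ {within `[0, 1] `*` setT, continuous H},
        forall x, H (0, x) = f x & forall x, H (1, x) = g x].
Arguments homotopic : clear implicits.
Arguments homotopic R {X Y} f g.

(* Stated as a numClosedFieldType, so that the library's norm topology on the
   carrier is inferred. *)
Definition Cplx (R : realType) : numClosedFieldType := R[i].

Section Projectivization.
Variables (R : realType) (m n : nat) (A : set 'M[Cplx R]_(m, n)).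

Definition proportional (u v : A) : bool :=
  `[< exists2 c : Cplx R, c != 0 & val v = c *: val u >].

Lemma proportional_equiv : equiv_class_of proportional.
Proof.
have sym u v : proportional u v -> proportional v u.
  move=> /asboolP[c c0 e]; apply/asboolP; exists c^-1; first by rewrite invr_eq0.
  by rewrite e scalerA mulVf// scale1r.
split=> [u|u v|v u w].
- by apply/asboolP; exists 1; rewrite ?oner_eq0// scale1r.
- by apply/idP/idP; exact: sym.
- move=> /asboolP[c c0 e] /asboolP[d d0 e']; apply/asboolP.
  by exists (d * c); rewrite ?mulf_neq0// e' e scalerA.
Qed.

Canonical proportional_equiv_rel := EquivRelPack proportional_equiv.

Definition projectivization : Type :=
  quotient_topology {eq_quot proportional}.

HB.instance Definition _ := Topological.on projectivization.

Definition proj_class (u : A) : projectivization :=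
  \pi_(quotient_topology {eq_quot proportional}) u.

Definition proj_repr (p : projectivization) : A :=
  repr (p : quotient_topology {eq_quot proportional}).

Lemma proj_reprK : cancel proj_repr proj_class.
Proof. by move=> p; exact: reprK. Qed.

Lemma proj_classP u v :
  proj_class u = proj_class v <->
  exists2 c : Cplx R, c != 0 & val v = c *: val u.
Proof.
split => [/eqmodP/asboolP //|h]; exact/eqmodP/asboolP.
Qed.

Lemma proj_class_continuous : continuous proj_class.
Proof. exact: pi_continuous. Qed.

Lemma continuous_proj (Z : topologicalType) (f : projectivization -> Z) :
  continuous (f \o proj_class) -> continuous f.
Proof. by move=> cf; apply/quotient_continuous. Qed.

End Projectivization.

Section Projective.
Variable R : realType.
Local Notation C := (Cplx R).

Definition nonzero_vectors : set 'cV[C]_3 := [set v | v != 0].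

Definition GL3 : set 'M[C]_3 := [set g | g \in unitmx].

Definition CP2 := projectivization nonzero_vectors.

Definition PGL3 := projectivization GL3.

HB.instance Definition _ := Topological.on CP2.
HB.instance Definition _ := Topological.on PGL3.

Lemma mulGL_subproof (g : GL3) (v : nonzero_vectors) :
  val g *m val v \in nonzero_vectors.
Proof.
have gU := set_valP g; have v0 := set_valP v; apply/mem_set => /=.
by apply: contra_neq v0 => e; rewrite -[val v](mulKmx gU) e mulmx0.
Qed.

Definition mulGL (g : GL3) (v : nonzero_vectors) : nonzero_vectors :=
  SigSub (mulGL_subproof g v).

Definition PGL3_act (g : PGL3) (p : CP2) : CP2 :=
  proj_class (mulGL (proj_repr g) (proj_repr p)).

Lemma PGL3_act_class g v :
  PGL3_act (proj_class g) (proj_class v) = proj_class (mulGL g v).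
Proof.
have /proj_classP[c c0 ec] := proj_reprK (proj_class g).
have /proj_classP[d d0 ed] := proj_reprK (proj_class v).
apply/proj_classP; exists (c * d); first by rewrite mulf_neq0.
by rewrite /= ec ed -scalemxAl -scalemxAr scalerA.
Qed.

(* the zero locus of the linear form [l]; these are the lines when [l != 0] *)
Definition line (l : 'rV[C]_3) : set CP2 :=
  [set p | l *m val (proj_repr p) = 0].

Lemma line_class l v : line l (proj_class v) <-> l *m val v = 0.
Proof.
rewrite /line /=; have /proj_classP[c c0 ->] := proj_reprK (proj_class v).
rewrite -scalemxAr; split => [->|/eqP]; first by rewrite scaler0.
by rewrite scaler_eq0 (negPf c0) => /eqP.
Qed.

Definition F4 : set {ptws 'I_4 -> CP2} :=
  [set p : {ptws 'I_4 -> CP2} | injective (p : 'I_4 -> CP2) /\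
    forall i j k, uniq [:: i; j; k] ->
      ~ exists2 l, l != 0 & [/\ line l (p i), line l (p j) & line l (p k)]].

Lemma S4_act_subproof (s : 'S_4) (p : F4) :
  (fun i => val p ((s^-1)%g i)) \in F4.
Proof.
have [pI pL] := set_valP p; apply/mem_set; split => [i j /pI/perm_inj//|].
move=> i j k u; apply: pL.
by rewrite -[[:: _; _; _]]/(map (s^-1)%g [:: i; j; k]) (map_inj_uniq perm_inj).
Qed.

(* a left action for the composition [(s t) i = s (t i)] of permutations;
   the library composes permutations in the opposite order *)
Definition S4_act (s : 'S_4) (p : F4) : F4 := SigSub (S4_act_subproof s p).

Lemma S4_act_continuous s : continuous (S4_act s).
Proof.
apply: continuous_to_set; apply: continuous_to_ptws => i p.
apply: (@continuous_comp _ _ _ set_val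
  (fun q : {ptws 'I_4 -> CP2} => q ((s^-1)%g i))).
  exact: set_val_continuous.
exact: ptws_continuous.
Qed.

HB.instance Definition _ s :=
  isContinuous.Build _ _ (S4_act s) (@S4_act_continuous s).

Lemma PGL3_act_inj g : injective (PGL3_act g).
Proof.
rewrite -[g]proj_reprK; move: (proj_repr g) => {}g p q.
rewrite -[p]proj_reprK -[q]proj_reprK !PGL3_act_class.
move: (proj_repr p) (proj_repr q) => v w /proj_classP[c c0 /= e].
apply/proj_classP; exists c => //; have gU := set_valP g.
by rewrite -[LHS](mulKmx gU) e -scalemxAr mulKmx.
Qed.

Lemma line_PGL3_act l g p :
  line l (PGL3_act g p) -> line (l *m val (proj_repr g)) p.
Proof.
rewrite -[g in X in X -> _]proj_reprK -[p]proj_reprK PGL3_act_class.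
by rewrite !line_class /= mulmxA.
Qed.

Lemma diag_act_subproof (g : PGL3) (p : F4) :
  (fun i => PGL3_act g (val p i)) \in F4.
Proof.
have [pI pL] := set_valP p; apply/mem_set; split.
  by move=> i j /PGL3_act_inj/pI.
move=> i j k u [l l0 [li lj lk]]; apply: (pL i j k u).
exists (l *m val (proj_repr g)); last by split; exact: line_PGL3_act.
have gU := set_valP (proj_repr g).
by apply: contra_neq l0 => e; rewrite -[LHS](mulmxK gU) e mul0mx.
Qed.

Definition diag_act (g : PGL3) (p : F4) : F4 := SigSub (diag_act_subproof g p).

Definition orbit_map (x : F4) (g : PGL3) : F4 := diag_act g x.

Lemma orbit_map_continuous x : continuous (orbit_map x).
Proof.
apply: continuous_to_set; apply: continuous_to_ptws => i.
apply: continuous_proj.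
set v := proj_repr (val x i).
rewrite (_ : _ \o _ = @proj_class _ _ _ _ \o (mulGL^~ v)); last first.
  apply/funext => g; rewrite /= -PGL3_act_class.
  by rewrite /v proj_reprK.
move=> g; apply: continuous_comp; last exact: proj_class_continuous.
move: g; apply: continuous_to_set; apply: continuous_mx => a b.
rewrite (_ : (fun _ => _) = fun g : GL3 =>
   \sum_j set_val g a j * val v j b); last first.
  by apply/funext => g; rewrite /= !set_valE /= mxE.
apply: continuous_mulr_sum => j g.
apply: (@continuous_comp _ _ _ set_val (fun M : 'M[C]_3 => M a j)).
  exact: set_val_continuous.
exact: mx_coord_continuous.
Qed.

HB.instance Definition _ x :=
  isContinuous.Build _ _ (orbit_map x) (@orbit_map_continuous x).

(* [cohomology_map] is contravariant, whence the inverse *)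
Definition S4_cohomology_act n (s : 'S_4) :
    cohomology R F4 n -> cohomology R F4 n :=
  cohomology_map (S4_act (s^-1)%g).

End Projective.
Arguments nonzero_vectors : clear implicits.
Arguments GL3 : clear implicits.
Arguments F4 : clear implicits.

(* Main.v *)
(** Four points in general position form a projective frame, so for every
    basepoint [x] the orbit map [g |-> g x] is a bijection from [PGL3] to [F4].
    Its inverse is given by Cramer's determinants in local lifts of the points
    to vectors, hence is continuous.  The permutation action commutes with
    [PGL3], so after this identification [s] acts by right multiplication by the
    unique [h] with [h x = s x].  A path from [h] to [1] in [GL3] exists because
    [(1 - z) h + z 1] is singular for finitely many complex [z] only, and it
    gives the homotopy from [s] to the identity.  Triviality on cohomology is
    homotopy invariance, proved with the prism operator. *)
Require Import Defs.
From HB Require Import structures.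
From mathcomp Require Import all_boot all_order all_algebra all_fingroup.
From mathcomp Require Import all_classical reals topology normedtype.
From mathcomp.real_closed Require Import complex.
From mathcomp Require Import zify ring.

Set Implicit Arguments.
Unset Strict Implicit.
Unset Printing Implicit Defensive.

Import Order.TTheory GRing.Theory Num.Theory.
Import numFieldNormedType.Exports.

Local Open Scope classical_set_scope.
Local Open Scope ring_scope.

(** * Homotopy invariance of singular cohomology *)

Lemma continuous_sum (K : numFieldType) (X : topologicalType) (I : Type)
    (r : seq I) (P : pred I) (f : I -> X -> K) :
  (forall i, continuous (f i)) ->
  continuous (fun x => \sum_(i <- r | P i) f i x).
Proof.
move=> cf x; apply: cvg_big => [|j _]; first exact: add_continuous.
exact: cf.
Qed.

Lemma continuous_pair (X Y Z : topologicalType) (f : X -> Y) (g : X -> Z) :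
  continuous f -> continuous g -> continuous (fun x => (f x, g x)).
Proof. by move=> cf cg x; apply: cvg_pair; [exact: cf | exact: cg]. Qed.

(** A homotopy is only continuous within [[0, 1]] times the space; this restores plain continuity of
    a composite that stays there. *)
Lemma continuous_comp_within (X Y Z : topologicalType) (A : set Y)
    (f : X -> Y) (g : Y -> Z) :
  {within A, continuous g} -> continuous f -> (forall x, A (f x)) ->
  continuous (g \o f).
Proof.
move=> /subspace_continuousP cg cf fA x.
apply: (cvg_comp f g _ (cg _ (fA x))) => U nU.
have {}nU : nbhs (f x) [set z | A z -> U z] := nU.
have nU' : nbhs x (f @^-1` [set z | A z -> U z]) := cf x _ nU.
by apply: filterS nU' => y; apply; exact: fA.
Qed.

(** * Affine simplices in the prism over a singular simplex *)

Section PrismSimplices.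
Variables (R : realType) (X Y : topologicalType).

(** Affine extension of a map of vertices, in barycentric coordinates. Faces and degeneracies are
    both of this form, so simplicial identities reduce to composing maps of vertices. *)
Definition push_row m n (u : 'I_m -> 'I_n) (t : 'rV[R]_m) : 'rV[R]_n :=
  \row_k \sum_(j | u j == k) t 0 j.

Lemma push_row_simplex m n (u : 'I_m.+1 -> 'I_n.+1) (t : std_simplex R m) :
  push_row u (val t) \in std_simplex R n.
Proof.
have [t0 t1] := set_valP t; apply/mem_set; split => [j|].
  by rewrite mxE; apply: sumr_ge0 => k _; exact: t0.
under eq_bigr do rewrite mxE.
rewrite -[RHS]t1 [RHS](partition_big u xpredT)//.
Qed.

Definition push_simplex_map m n (u : 'I_m.+1 -> 'I_n.+1)
    (t : std_simplex R m) : std_simplex R n :=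
  SigSub (push_row_simplex u t).

Lemma continuous_sum_coord m (P : pred 'I_m.+1) :
  continuous (fun t : std_simplex R m => \sum_(j | P j) set_val t 0 j).
Proof.
apply: continuous_sum => j t.
apply: (@continuous_comp _ _ _ set_val (fun M : 'rV[R]_m.+1 => M 0 j)).
  exact: set_val_continuous.
exact: mx_coord_continuous.
Qed.

Lemma push_simplex_map_continuous m n (u : 'I_m.+1 -> 'I_n.+1) :
  continuous (push_simplex_map u).
Proof.
apply: continuous_to_set; apply: continuous_mx => a k.
rewrite (_ : (fun _ => _) = fun t : std_simplex R m =>
    \sum_(j | u j == k) set_val t 0 j); first exact: continuous_sum_coord.
by apply/funext => t; rewrite /= set_valE /= mxE.
Qed.

Lemma push_row_comp m n p (u : 'I_m -> 'I_n) (v : 'I_n -> 'I_p)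
    (t : 'rV[R]_m) :
  push_row v (push_row u t) = push_row (v \o u) t.
Proof.
apply/rowP => k; rewrite !mxE; under eq_bigr do rewrite mxE.
rewrite [RHS](partition_big u (fun j => v j == k))//=.
apply: eq_bigr => j /eqP vj; apply: eq_bigl => i.
by case: (eqVneq (u i) j) => [->|]; rewrite ?andbF// vj eqxx.
Qed.

Lemma face_row_push n (i : 'I_n.+2) (t : 'rV[R]_n.+1) :
  face_row i t = push_row (lift i) t.
Proof.
apply/rowP => j; rewrite !mxE; case: unliftP => [k ->|->].
  by rewrite (big_pred1 k)// => l; rewrite (inj_eq lift_inj).
by rewrite big_pred0// => l; apply/negbTE; rewrite eq_sym neq_lift.
Qed.

(** The height in the prism: the affine function equal to 1 at the vertices marked by [b] and 0 at
    the others. *)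
Definition top_weight m (b : 'I_m -> bool) (t : 'rV[R]_m) : R :=
  \sum_(j | b j) t 0 j.

Lemma top_weight_push m n (u : 'I_m -> 'I_n) (b : 'I_n -> bool) t :
  top_weight b (push_row u t) = top_weight (b \o u) t.
Proof.
rewrite /top_weight; under eq_bigr do rewrite mxE.
rewrite [RHS](partition_big u b)//=.
apply: eq_bigr => j bj; apply: eq_bigl => i.
by case: (eqVneq (u i) j) => [->|]; rewrite ?andbF// bj.
Qed.

Lemma top_weight_itv m (b : 'I_m.+1 -> bool) (t : std_simplex R m) :
  top_weight b (val t) \in `[0, 1].
Proof.
have [t0 t1] := set_valP t.
rewrite in_itv /= sumr_ge0 => [/=|j _]; last exact: t0.
rewrite -t1 [leRHS](bigID b)/= lerDl sumr_ge0// => j _; exact: t0.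
Qed.

Variables (H : R * X -> Y).
Hypothesis cH : {within `[0, 1] `*` setT, continuous H}.

(* A map [u] from the vertices of a simplex to those of the prism
   [std_simplex R n * [0, 1]] extends affinely; the second component of [u]
   says which vertices go to the top. *)
Definition prism_fun m n (s : singular_simplex R X n)
    (u : 'I_m.+1 -> 'I_n.+1 * bool) (t : std_simplex R m) : Y :=
  H (top_weight (snd \o u) (val t), s (push_simplex_map (fst \o u) t)).

Lemma prism_fun_continuous m n (s : singular_simplex R X n)
    (u : 'I_m.+1 -> 'I_n.+1 * bool) : continuous (prism_fun s u).
Proof.
apply: (continuous_comp_within (f := fun t => (_, _)) cH) => [|t]; last first.
  by split => //=; exact: top_weight_itv.
apply: continuous_pair.
  rewrite (_ : (fun _ => _) = fun t : std_simplex R m =>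
    \sum_(j | (u j).2) set_val t 0 j); first exact: continuous_sum_coord.
  by apply/funext => t; rewrite set_valE.
move=> t; apply: (@continuous_comp _ _ _ (push_simplex_map (fst \o u)) s).
  exact: push_simplex_map_continuous.
exact: cts_fun.
Qed.

HB.instance Definition _ m n (s : singular_simplex R X n)
    (u : 'I_m.+1 -> 'I_n.+1 * bool) :=
  isContinuous.Build _ _ (prism_fun s u) (@prism_fun_continuous m n s u).

Definition prism m n (s : singular_simplex R X n)
    (u : 'I_m.+1 -> 'I_n.+1 * bool) : singular_simplex R Y m :=
  prism_fun s u.

(** A face of the prism simplex precomposes [u] with [lift i], whereas a face of the base simplex
    ([prism_face]) postcomposes it. *)
Lemma face_prism m n (s : singular_simplex R X n)
    (u : 'I_m.+2 -> 'I_n.+1 * bool) i :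
  face i (prism s u) = prism s (u \o lift i).
Proof.
apply/continuousEP => t.
rewrite /face /prism /= /prism_fun /= face_row_push top_weight_push.
congr (H (_, s _)); apply: val_inj => /=.
by rewrite face_row_push push_row_comp.
Qed.

Lemma prism_face m n (s : singular_simplex R X n.+1)
    (u : 'I_m.+1 -> 'I_n.+1 * bool) i :
  prism (face i s) u = prism s (fun k => (lift i (u k).1, (u k).2)).
Proof.
apply/continuousEP => t; rewrite /face /prism /= /prism_fun /=.
congr (H (_, s _)); apply: val_inj => /=.
by rewrite face_row_push push_row_comp.
Qed.

(** Evaluates the bottom and the top of the prism, the two terms that survive the telescoping. *)
Lemma prism_cst n (s : singular_simplex R X n) (b : bool)
    (u : 'I_n.+1 -> 'I_n.+1 * bool) (t : std_simplex R n) :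
  (forall k, u k = (k, b)) -> prism s u t = H (b%:R, s t).
Proof.
move=> ub; rewrite /prism /= /prism_fun /=.
have [t0 t1] := set_valP t.
congr (H (_, s _)).
  rewrite /top_weight (eq_bigl (fun=> b)); last by move=> k; rewrite /= ub.
  by case: b {ub} => /=; [exact: t1 | rewrite big_pred0_eq].
apply: val_inj => /=; apply/rowP => k; rewrite mxE (big_pred1 k)// => j.
by rewrite /= ub.
Qed.

End PrismSimplices.

(* The hypotheses are the identities of a simplicial homotopy, with
   [a i j = d_i h_j] and [b i j = h_j d_i]. *)
Lemma simplicial_homotopy_sum (V : comPzRingType) (n : nat)
    (a b : nat -> nat -> V) :
  (forall i j, (i < j)%N -> a i j = b i j.-1) ->
  (forall j, a j.+1 j.+1 = a j.+1 j) ->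
  (forall i j, (j.+1 < i)%N -> a i j = b i.-1 j) ->
  \sum_(0 <= j < n.+1) (-1) ^+ j * (\sum_(0 <= i < n.+2) (-1) ^+ i * a i j)
  + \sum_(0 <= j < n) (-1) ^+ j * (\sum_(0 <= i < n.+1) (-1) ^+ i * b i j)
  = a 0%N 0%N - a n.+1 n.+1.
Proof.
move=> alt adiag agt.
(* Split the sum over [i] at [j] and [j.+1]. The two middle terms have total signs +1 and -1 and
   will telescope in [j]; the others turn into values of [b]. *)
have inner j : (j < n.+1)%N ->
   (-1) ^+ j * (\sum_(0 <= i < n.+2) (-1) ^+ i * a i j)
   = (a j j - a j.+1 j.+1) +
     ((-1) ^+ j * (\sum_(0 <= i < j) (-1) ^+ i * b i j.-1)
     - (-1) ^+ j * (\sum_(j.+1 <= i < n.+1) (-1) ^+ i * b i j)).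
  move=> jn; rewrite (@big_cat_nat _ _ _ j)//=; last by lia.
  rewrite (@big_ltn _ _ _ j) ?[in LHS](@big_ltn _ _ _ j.+1); [|by lia..].
  rewrite adiag (@eq_big_nat _ _ _ 0 j _ (fun i => (-1) ^+ i * b i j.-1));
    last by move=> i ij; rewrite alt.
  rewrite big_add1 /= (@eq_big_nat _ _ _ j.+1 n.+1 _
    (fun i => - ((-1) ^+ i * b i j))); last first.
    by move=> i ij; rewrite agt ?exprS ?mulN1r ?mulNr//; lia.
  rewrite sumrN !mulrDr !mulrA mulrN exprS mulN1r mulrN -expr2.
  rewrite -signr_odd -exprM mulnC exprM sqrrN expr1n expr1n; ring.
under eq_big_nat => j jn do rewrite inner//.
(* The [b]-terms cancel: after a shift of [j], the part below the diagonal covers [i <= j], the part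
   above covers [i > j], and together they are the opposite of the second double sum. *)
rewrite big_split /= -addrA [X in _ + X](_ : _ = 0); last first.
  rewrite big_split /= big_nat_recl//= big_geq// mulr0 add0r sumrN.
  rewrite [in X in _ - X + _]big_nat_recr//= (@big_geq _ _ _ n.+1)//.
  rewrite mulr0 addr0.
  rewrite -sumrB -big_split /= big_nat big1// => j jn.
  rewrite [in X in _ + X](@big_cat_nat _ _ _ j.+1)//=; last by lia.
  by rewrite exprS; ring.
rewrite addr0 -[RHS]opprB -(telescope_sumr (fun j => a j j) (leq0n n.+1)).
rewrite -sumrN.
by apply: eq_bigr => j _; rewrite opprB.
Qed.

Lemma cohomology_class_surj (R : realType) (X : topologicalType) n
    (a : cohomology R X n) : exists z, cohomology_class z = a.
Proof. by eexists; exact: cohomology_classK. Qed.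

(** * The prism operator as a cochain homotopy *)

Section HomotopyInvariance.
Variables (R : realType) (X Y : topologicalType) (f g : continuousType X Y).
Variables (H : R * X -> Y).
Hypothesis cH : {within `[0, 1] `*` setT, continuous H}.
Hypotheses (H0 : forall x, H (0, x) = f x) (H1 : forall x, H (1, x) = g x).

(** The [j]-th simplex of the standard triangulation of the prism: vertices 0, ..., j at the bottom,
    followed by j, ..., n at the top. *)
Definition prism_vertex n j (k : 'I_n.+2) : 'I_n.+1 * bool :=
  (inord (unbump j k), (j < k)%N).

Definition prism_operator n (c : cochain R Y n.+1) : cochain R X n :=
  fun s => \sum_(0 <= j < n.+1) (-1) ^+ j * c (prism cH s (@prism_vertex n j)).

(** The value of [c] on the [i]-th face of the [j]-th prism simplex. Natural indices let [i] and [j]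
    leave their ranges, and let [face_prism_value] make sense in degree 0, where [s] has no
    faces. *)
Definition prism_face_value n (c : cochain R Y n) (s : singular_simplex R X n)
    (i j : nat) : rat :=
  c (prism cH s (fun k : 'I_n.+1 =>
      (inord (unbump j (bump i k)), (j < bump i k)%N))).

Definition face_prism_value n (c : cochain R Y n) (s : singular_simplex R X n)
    (i j : nat) : rat :=
  c (prism cH s (fun k : 'I_n.+1 =>
      (inord (bump i (unbump j k)), (j < k)%N))).

(** The cochain homotopy formula at [s], in a form that includes degree 0, where the second sum is
    empty. *)
Lemma prism_face_value_sum n (c : cochain R Y n) (s : singular_simplex R X n) :
  \sum_(0 <= j < n.+1) (-1) ^+ j *
    (\sum_(0 <= i < n.+2) (-1) ^+ i * prism_face_value c s i j)
  + \sum_(0 <= j < n) (-1) ^+ j *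
    (\sum_(0 <= i < n.+1) (-1) ^+ i * face_prism_value c s i j)
  = cochain_map g c s - cochain_map f c s.
Proof.
rewrite simplicial_homotopy_sum.
(* The term at (0, 0) has all its vertices at the top and gives [g]; the one at (n+1, n+1), just
   outside the range of [j], has all of them at the bottom and gives [f]. *)
- congr (_ - _); congr (c _); apply/continuousEP => t /=.
    rewrite (@prism_cst _ _ _ _ _ _ _ true) ?H1// => k.
    by rewrite [unbump _ _](_ : _ = k :> nat) ?inord_val// /unbump /bump; lia.
  rewrite (@prism_cst _ _ _ _ _ _ _ false) ?H0// => k.
  have kn := ltn_ord k; rewrite [unbump _ _](_ : _ = k :> nat); last first.
    by rewrite /unbump /bump; lia.
  by rewrite inord_val; congr (_, _); rewrite /bump; lia.
- move=> i j ij; congr (c (prism _ _ _)); apply/funext => k.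
  by congr (inord _, _); rewrite /unbump /bump; lia.
- move=> j; congr (c (prism _ _ _)); apply/funext => k.
  by congr (inord _, _); rewrite /unbump /bump; lia.
- move=> i j ij; congr (c (prism _ _ _)); apply/funext => k.
  by congr (inord _, _); rewrite /unbump /bump; lia.
Qed.

Lemma prism_operator_coboundary n (c : cochain R Y n)
    (s : singular_simplex R X n) :
  prism_operator (coboundary c) s = \sum_(0 <= j < n.+1) (-1) ^+ j *
    (\sum_(0 <= i < n.+2) (-1) ^+ i * prism_face_value c s i j).
Proof.
apply: eq_bigr => j _; congr (_ * _); rewrite big_mkord.
by apply: eq_bigr => i _; rewrite face_prism.
Qed.

Lemma coboundary_prism_operator n (c : cochain R Y n.+1)
    (s : singular_simplex R X n.+1) :
  coboundary (prism_operator c) s = \sum_(0 <= j < n.+1) (-1) ^+ j *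
    (\sum_(0 <= i < n.+2) (-1) ^+ i * face_prism_value c s i j).
Proof.
rewrite /coboundary /prism_operator.
under eq_bigr do rewrite mulr_sumr.
rewrite exchange_big /=; apply: eq_big_nat => j jn.
rewrite mulr_sumr big_mkord; apply: eq_bigr => i _; rewrite mulrCA.
congr (_ * (_ * c _)); rewrite prism_face; congr (prism _ _ _).
apply/funext => k; congr (_, _); apply: val_inj => /=.
have kn := ltn_ord k; have ni := ltn_ord i.
by rewrite !inordK//; rewrite /bump /unbump; lia.
Qed.

Lemma homotopy_cohomology_map n (a : cohomology R Y n) :
  cohomology_map f a = cohomology_map g a.
Proof.
have [z <-] := cohomology_class_surj a; move=> {a}.
rewrite !cohomology_map_class; apply/esym/cohomology_classP/asboolP.
have /eqP dz := valP z.
have Dz s : prism_operator (coboundary (val z)) s = 0.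
  by rewrite dz /prism_operator big1// => j _; rewrite mulr0.
(* In degree 0 the difference itself must vanish; in higher degrees the prism operator provides the
   primitive. *)
case: n z dz Dz => [|n] z dz Dz /=.
  apply/funext => s; rewrite -[LHS]prism_face_value_sum.
  by rewrite [X in _ + X]big_geq// addr0 -prism_operator_coboundary Dz.
exists (prism_operator z); apply/funext => s.
rewrite -[LHS]prism_face_value_sum -prism_operator_coboundary Dz add0r.
by rewrite coboundary_prism_operator.
Qed.

End HomotopyInvariance.

Lemma homotopic_cohomology_map (R : realType) (X Y : topologicalType)
    (f g : continuousType X Y) :
  homotopic R f g -> forall n (a : cohomology R Y n),
  cohomology_map f a = cohomology_map g a.
Proof. by move=> [H [cH H0 H1]] n a; exact: (homotopy_cohomology_map cH). Qed.

Lemma cohomology_map_cancel (R : realType) (X Y : topologicalType)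
    (f : continuousType X Y) (g : continuousType Y X) n :
  cancel f g ->
  cancel (cohomology_map g : cohomology R X n -> _) (cohomology_map f).
Proof.
move=> fK a; have [z <-] := cohomology_class_surj a.
rewrite !cohomology_map_class.
congr cohomology_class; apply: val_inj; apply/funext => s.
by congr (val z _); apply/continuousEP => t; exact: fK.
Qed.

Lemma cohomology_map_id (R : realType) (X : topologicalType) n
    (a : cohomology R X n) : cohomology_map idfun a = a.
Proof.
have [z <-] := cohomology_class_surj a; rewrite cohomology_map_class.
congr cohomology_class; apply: val_inj; apply/funext => s.
by congr (val z _); exact/continuousEP.
Qed.

(** * The orbit map is a homeomorphism *)

Section OpenQuotient.
Variables (R : realType) (m n : nat) (A : set 'M[Cplx R]_(m, n)).
Hypothesis A_scale : forall (c : Cplx R) M, c != 0 -> A M -> A (c *: M).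

Lemma scale_in_subproof (c : Cplx R) (c0 : c != 0) (u : A) :
  c *: val u \in A.
Proof. by apply/mem_set/A_scale => //; exact: set_valP. Qed.

Definition scale_in c (c0 : c != 0) (u : A) : A :=
  SigSub (scale_in_subproof c0 u).

Lemma scale_in_continuous c (c0 : c != 0) : continuous (scale_in c0).
Proof.
apply: continuous_to_set; apply: continuous_mx => i j.
(* The one-term sum has the shape of [continuous_mulr_sum]. *)
rewrite (_ : (fun _ => _) = fun u : A => \sum_(k < 1) set_val u i j * c).
  apply: continuous_mulr_sum => _ u.
  apply: (@continuous_comp _ _ _ set_val (fun M : 'M[Cplx R]_(m, n) => M i j)).
    exact: set_val_continuous.
  exact: mx_coord_continuous.
by apply/funext => u; rewrite big_ord1 /= !set_valE /= mxE mulrC.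
Qed.

(** The saturation of [U] is the union of its preimages under the scalings, each of which is
    continuous. *)
Lemma proj_class_open (U : set A) : open U -> open (@proj_class _ _ _ A @` U).
Proof.
move=> oU.
have sat : @proj_class _ _ _ A @^-1` (@proj_class _ _ _ A @` U) =
    \bigcup_(c : {c : Cplx R | c != 0}) (scale_in (valP c) @^-1` U).
  apply/seteqP; split => [u [v Uv /proj_classP[c c0 e]]|u [[c c0] _ Uc]] /=.
    have c0' : c^-1 != 0 by rewrite invr_eq0.
    exists (exist (fun c : Cplx R => c != 0) _ c0') => //=.
    rewrite [scale_in _ _](_ : _ = v)//.
    by apply: val_inj; rewrite /= e scalerA mulVf// scale1r.
  exists (scale_in (valP (exist (fun c : Cplx R => c != 0) c c0)) u) => //.
  by apply/esym/proj_classP; exists c.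
suff : open (@proj_class _ _ _ A @^-1` (@proj_class _ _ _ A @` U)) by [].
rewrite sat; apply: bigcup_open => c _.
by have /continuousP := @scale_in_continuous _ (valP c); exact.
Qed.

Lemma nbhs_proj_class (u : A) (P : set (projectivization A)) :
  nbhs u (@proj_class _ _ _ A @^-1` P) -> nbhs (proj_class u) P.
Proof.
rewrite nbhsE => -[O [oO Ou] OP]; rewrite nbhsE.
exists (@proj_class _ _ _ A @` O).
  by split; [exact: proj_class_open|exists u].
by move=> _ [v Ov <-]; exact: OP.
Qed.

End OpenQuotient.

Lemma proj_class_surj (R : realType) m n (A : set 'M[Cplx R]_(m, n))
  (p : projectivization A) : exists u, p = proj_class u.
Proof. by eexists; exact/esym/proj_reprK. Qed.

(** * Joint continuity of the projective action *)

Section Action.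
Variable R : realType.
Local Notation C := (Cplx R).

Lemma GL3_scale (c : C) M : c != 0 -> GL3 R M -> GL3 R (c *: M).
Proof. by move=> c0; rewrite /GL3 /= unitmxZ ?unitfE. Qed.

Lemma nonzero_scale (c : C) v :
  c != 0 -> nonzero_vectors R v -> nonzero_vectors R (c *: v).
Proof. by move=> c0; rewrite /nonzero_vectors /= scaler_eq0 (negPf c0). Qed.

Lemma continuous_mul (X : topologicalType) (f g : X -> C) :
  continuous f -> continuous g -> continuous (fun x => f x * g x).
Proof. by move=> cf cg x; apply: cvgM; [exact: cf|exact: cg]. Qed.

Lemma continuous_set_coord (X : topologicalType) m n (A : set 'M[C]_(m, n))
    (f : X -> A) i j : continuous f -> continuous (fun x => val (f x) i j).
Proof.
move=> cf x; apply: (@continuous_comp _ _ _ (set_val \o f)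
  (fun M : 'M[C]_(m, n) => M i j)).
  by apply: continuous_comp; [exact: cf|exact: set_val_continuous].
exact: mx_coord_continuous.
Qed.

Lemma mulGL_continuous :
  continuous (fun gv : GL3 R * nonzero_vectors R => mulGL gv.1 gv.2).
Proof.
apply: continuous_to_set; apply: continuous_mx => i j.
rewrite (_ : (fun _ => _) = fun gv : GL3 R * nonzero_vectors R =>
    \sum_k val gv.1 i k * val gv.2 k j); last first.
  by apply/funext => gv; rewrite /= set_valE /= mxE.
apply: continuous_sum => k; apply: continuous_mul;
  apply: continuous_set_coord => gv; [exact: cvg_fst|exact: cvg_snd].
Qed.

(** A product of quotient maps need not be a quotient map. Here both projections are open, so a
    product neighbourhood found upstairs maps to one downstairs. *)
Lemma PGL3_act_continuous :
  continuous (fun gp : PGL3 R * CP2 R => PGL3_act gp.1 gp.2).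
Proof.
move=> [g p]; have [{}g ->] := proj_class_surj g.
have [v ->] := proj_class_surj p; move=> W nW.
have {}nW : nbhs (proj_class (mulGL g v)) W by rewrite -PGL3_act_class.
have : nbhs (g, v) ((fun gv : GL3 R * nonzero_vectors R =>
    proj_class (mulGL gv.1 gv.2)) @^-1` W).
  exact: (@mulGL_continuous (g, v) _
    (@proj_class_continuous _ _ _ _ (mulGL g v) _ nW)).
move=> [[U V] /= [nU nV] UV].
exists (@proj_class _ _ _ _ @` U, @proj_class _ _ _ _ @` V).
  split; [apply: nbhs_proj_class; first exact: GL3_scale|
          apply: nbhs_proj_class; first exact: nonzero_scale].
    by apply: filterS nU => y Uy; exists y.
  by apply: filterS nV => y Vy; exists y.
move=> [_ _] [/= [a Ua <-] [b Vb <-]]; rewrite PGL3_act_class.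
exact: (UV (a, b)).
Qed.

Lemma diag_act_continuous (X : topologicalType) (g : X -> PGL3 R)
    (q : X -> F4 R) :
  continuous g -> continuous q -> continuous (fun y => diag_act (g y) (q y)).
Proof.
move=> cg cq; apply: continuous_to_set; apply: continuous_to_ptws => i y.
apply: (@continuous_comp _ _ _ (fun y => (g y, val (q y) i))
  (fun gp : PGL3 R * CP2 R => PGL3_act gp.1 gp.2)); last first.
  exact: PGL3_act_continuous.
move: y; apply: continuous_pair => // y.
apply: (@continuous_comp _ _ _ q (fun p : F4 R => val p i)); first exact: cq.
apply: (@continuous_comp _ _ _ set_val (fun p : {ptws 'I_4 -> CP2 R} => p i)).
  exact: set_val_continuous.
exact: ptws_continuous.
Qed.

End Action.

(** * Projective frames and Cramer's rule *)

Section Frames.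
Variables (F : fieldType) (n : nat).
Implicit Types v : 'I_n.+1 -> 'cV[F]_n.

Definition select_mx v (r : 'I_n -> 'I_n.+1) : 'M[F]_n :=
  \matrix_(i, k) v (r k) i 0.

Definition init_index : 'I_n -> 'I_n.+1 := lift ord_max.

Definition replace_index (j k : 'I_n) : 'I_n.+1 :=
  if k == j then ord_max else init_index k.

Definition general_position v :=
  forall r : 'I_n -> 'I_n.+1, injective r -> \det (select_mx v r) != 0.

(** Coefficients of Cramer's relation: the combination of the first [n] vectors with these
    coefficients is [frame_coef v ord_max] times the last vector. *)
Definition frame_coef v (i : 'I_n.+1) : F :=
  \det (select_mx v (if unlift ord_max i is Some k
                     then replace_index k else init_index)).

Definition std_frame (i : 'I_n.+1) : 'cV[F]_n :=
  if unlift ord_max i is Some k then delta_mx k 0 else const_mx 1.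

(* Scaling the first [n] vectors by Cramer's coefficients makes their sum
   proportional to the last one. *)
Definition frame v : 'M[F]_n :=
  \matrix_(i, k) (frame_coef v (init_index k) * v (init_index k) i 0).

Lemma init_index_inj : injective init_index.
Proof. exact: lift_inj. Qed.

Lemma replace_index_inj j : injective (replace_index j).
Proof.
have neq k : init_index k != ord_max by rewrite eq_sym neq_lift.
move=> k l; rewrite /replace_index.
case: eqVneq => [->|kj]; case: eqVneq => [->|lj] // e.
- by have := neq l; rewrite -e eqxx.
- by have := neq k; rewrite e eqxx.
- exact: init_index_inj.
Qed.

Lemma frame_coef_neq0 v i : general_position v -> frame_coef v i != 0.
Proof.
move=> gv; apply: gv; case: (unlift _ _) => [k|].
  exact: replace_index_inj.
exact: init_index_inj.
Qed.

Lemma frame_coef_init v k :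
  frame_coef v (init_index k) = \det (select_mx v (replace_index k)).
Proof. by rewrite /frame_coef /init_index liftK. Qed.

Lemma frame_coef_max v :
  frame_coef v ord_max = \det (select_mx v init_index).
Proof. by rewrite /frame_coef unlift_none. Qed.

(** Expand along the replaced column [k]: its cofactors do not see that column, so they are those of
    the original matrix. *)
Lemma frame_coef_adj v k :
  frame_coef v (init_index k) =
  (\adj (select_mx v init_index) *m v ord_max) k 0.
Proof.
rewrite frame_coef_init (expand_det_col _ k) mxE; apply: eq_bigr => i _.
rewrite !mxE /replace_index eqxx mulrC; congr (_ * _).
rewrite /cofactor; congr (_ * \det _); apply/matrixP => a b.
by rewrite !mxE eq_sym (negPf (neq_lift _ _)).
Qed.

(** For the last vector this is the product of a matrix with its adjugate. *)
Lemma frame_std v i : frame v *m std_frame i = frame_coef v i *: v i.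
Proof.
rewrite /std_frame; case: unliftP => [k ->|->].
  by rewrite -colE; apply/colP => a; rewrite !mxE.
rewrite frame_coef_max -mul_scalar_mx -mul_mx_adj -mulmxA.
apply/colP => a; rewrite !mxE; apply: eq_bigr => k _.
by rewrite -frame_coef_adj !mxE mulr1 mulrC.
Qed.

Lemma frame_unit v : general_position v -> frame v \in unitmx.
Proof.
move=> gv.
have -> : frame v = select_mx v init_index *m
    diag_mx (\row_k frame_coef v (init_index k)).
  by apply/matrixP => i k; rewrite mul_mx_diag !mxE mulrC.
rewrite unitmxE unitfE det_mulmx mulf_neq0//; first exact/gv/init_index_inj.
by rewrite det_diag; apply/prodf_neq0 => k _; rewrite mxE frame_coef_neq0.
Qed.

Lemma frame_quotient v w i : general_position v -> general_position w ->
  frame v *m invmx (frame w) *m w i =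
  (frame_coef v i / frame_coef w i) *: v i.
Proof.
move=> gv gw.
have -> : w i = (frame_coef w i)^-1 *: (frame w *m std_frame i).
  by rewrite frame_std scalerA mulVf ?scale1r// frame_coef_neq0.
rewrite -scalemxAr mulmxA mulmxKV ?frame_unit// frame_std.
by rewrite scalerA mulrC.
Qed.

(** The first [n] vectors make [g] equal to [h] times a diagonal matrix in the frame basis; the last
    one, the sum of that basis, forces the diagonal entries to agree. *)
Lemma general_position_proportional v (g h : 'M[F]_n) (c : 'I_n.+1 -> F) :
  general_position v -> h \in unitmx ->
  (forall i, g *m v i = c i *: (h *m v i)) -> g = c ord_max *: h.
Proof.
move=> gv hU gh; have fU := frame_unit gv.
have gB i : g *m frame v *m std_frame i = c i *: (h *m frame v *m std_frame i).
  rewrite -!mulmxA frame_std -!scalemxAr gh.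
  by rewrite !scalerA mulrC.
have gD : g *m frame v = h *m frame v *m diag_mx (\row_k c (init_index k)).
  apply/matrixP => i k.
  have /colP/(_ i) := gB (init_index k).
  by rewrite /std_frame /init_index liftK -!colE mul_mx_diag !mxE mulrC => ->.
have hfU : h *m frame v \in unitmx by rewrite unitmx_mul hU.
have /(congr1 (mulmx (invmx (h *m frame v)))) := gB ord_max.
move: gD hfU; set hf := h *m frame v => gD hfU.
rewrite gD -scalemxAr -[hf *m _ *m _]mulmxA !mulKmx//.
rewrite /std_frame unlift_none => /colP e.
have {}e k : c (init_index k) = c ord_max.
  have := e k; rewrite mul_diag_mx !mxE !mulr1; exact.
rewrite -[LHS](mulmxK fU) gD; rewrite (_ : diag_mx _ = (c ord_max)%:M).
  by rewrite mul_mx_scalar -scalemxAl /hf mulmxK.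
by rewrite -diag_const_mx; congr diag_mx; apply/rowP => k; rewrite !mxE.
Qed.

End Frames.

(** * Limits of matrices, determinants and frames *)

Section MatrixConvergence.
Variables (T : Type) (F : set_system T).
Context {FF : Filter F}.

Lemma cvg_mx (S : topologicalType) m n (f : T -> 'M[S]_(m, n))
    (A : 'M[S]_(m, n)) :
  (forall i j, f x i j @[x --> F] --> A i j) -> f x @[x --> F] --> A.
Proof.
move=> cf U [P HP PU].
have H : forall ij : 'I_m * 'I_n,
    \forall x \near F, P ij.1 ij.2 (f x ij.1 ij.2).
  by move=> [i j]; apply: cf; exact: HP.
apply: filterS (filter_forall _ H) => x Hx; apply: PU => i j.
exact: (Hx (i, j)).
Qed.

Lemma cvg_det (K : numFieldType) n (f : T -> 'M[K]_n) (A : 'M[K]_n) :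
  (forall i j, f x i j @[x --> F] --> A i j) ->
  \det (f x) @[x --> F] --> \det A.
Proof.
move=> cf; apply: cvg_big => [|s _]; first exact: add_continuous.
apply: cvgMl_tmp; apply: cvg_big => [|i _]; first exact: mul_continuous.
exact: cf.
Qed.

Lemma cvg_frame (K : numFieldType) n (f : T -> 'I_n.+1 -> 'cV[K]_n)
    (v : 'I_n.+1 -> 'cV[K]_n) :
  (forall i j, f x i j 0 @[x --> F] --> v i j 0) ->
  forall i j, frame (f x) i j @[x --> F] --> frame v i j.
Proof.
move=> cf i j; rewrite mxE.
under eq_cvg => x do rewrite mxE.
apply: cvgM; last exact: cf.
apply: cvg_det => a b; rewrite mxE; under eq_cvg => x do rewrite mxE.
exact: cf.
Qed.

End MatrixConvergence.

(** * Local lifts of points to vectors *)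

Section LocalLifts.
Variable R : realType.
Local Notation C := (Cplx R).

(** The affine chart: the representative with coordinate [k] equal to 1, independent of the choice
    made by [proj_repr]. It is zero when that coordinate vanishes. *)
Definition lift_at (k : 'I_3) (p : CP2 R) : 'cV[C]_3 :=
  (val (proj_repr p) k 0)^-1 *: val (proj_repr p).

Lemma lift_at_class k (u : nonzero_vectors R) :
  lift_at k (proj_class u) = (val u k 0)^-1 *: val u.
Proof.
rewrite /lift_at; have /proj_classP[c c0 ->] := proj_reprK (proj_class u).
by rewrite [in RHS]mxE scalerA invfM mulrAC mulVf// mul1r.
Qed.

Lemma cvg_lift_at k (u : nonzero_vectors R) i : val u k 0 != 0 ->
  lift_at k q i 0 @[q --> (proj_class u : CP2 R)] -->
  lift_at k (proj_class u) i 0.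
Proof.
move=> uk W nW; apply: nbhs_proj_class; first exact: nonzero_scale.
have coord j : {for u, continuous (fun w : nonzero_vectors R => val w j 0)}.
  by apply: (continuous_set_coord (f := id)) => w V.
have cuv : {for u, continuous (fun w : nonzero_vectors R =>
    (val w k 0)^-1 * val w i 0)}.
  exact: continuousM (continuousV uk (coord k)) (coord i).
rewrite lift_at_class mxE in nW.
have {}cuv : nbhs u [set w : nonzero_vectors R |
    W ((val w k 0)^-1 * val w i 0)] := cuv _ nW.
by apply: filterS cuv => w /=; rewrite lift_at_class mxE.
Qed.

Definition is_lift (p : 'I_4 -> CP2 R) (v : 'I_4 -> 'cV[C]_3) :=
  forall i, exists2 u : nonzero_vectors R, val u = v i & proj_class u = p i.

Lemma lift_at_near k (u : nonzero_vectors R) : val u k 0 != 0 ->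
  \forall q \near (proj_class u : CP2 R),
    exists2 w : nonzero_vectors R, val w = lift_at k q & proj_class w = q.
Proof.
move=> uk; apply: nbhs_proj_class; first exact: nonzero_scale.
have coord : {for u, continuous (fun w : nonzero_vectors R => val w k 0)}.
  by apply: (continuous_set_coord (f := id)) => w V.
have near_uk : nbhs u [set w : nonzero_vectors R | val w k 0 != 0] :=
  @cvgr_neq0 _ _ _ (nbhs u) (nbhs_filter u) _ _ coord uk.
apply: filterS near_uk => w /= wk.
have wk' : (val w k 0)^-1 != 0 by rewrite invr_eq0.
exists (scale_in (@nonzero_scale R) wk' w); first by rewrite lift_at_class.
by apply/esym/proj_classP; exists (val w k 0)^-1.
Qed.

Definition repr_lift (p : F4 R) (i : 'I_4) : 'cV[C]_3 :=
  val (proj_repr (val p i)).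

Lemma repr_liftP (p : F4 R) : is_lift (val p) (repr_lift p).
Proof. by move=> i; exists (proj_repr (val p i)) => //; exact: proj_reprK. Qed.

(** A nonzero left null vector of the selected matrix is a linear form whose line contains three of
    the points. *)
Lemma F4_general_position (p : F4 R) v :
  is_lift (val p) v -> general_position v.
Proof.
move=> pv r rI; apply/eqP => /eqP/det0P[l l0 lv].
have [_ pL] := set_valP p.
have onl k : line l (val p (r k)).
  have [u uv <-] := pv (r k); apply/line_class; rewrite uv.
  apply/matrixP => a b; rewrite !ord1.
  move/matrixP: lv => /(_ 0 k); rewrite !mxE => lk.
  rewrite -[RHS]lk.
  by apply: eq_bigr => j _; rewrite !mxE.
apply: (pL (r 0) (r 1) (r 2%:R)); last by exists l => //; split; exact: onl.
by rewrite -[[:: _; _; _]]/(map r [:: 0; 1; 2%:R]) map_inj_uniq.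
Qed.

Lemma GL3_1 : (1%:M : 'M[C]_3) \in GL3 R.
Proof. by apply/mem_set; exact: unitmx1. Qed.

(* junk value [1] on singular matrices *)
Definition GL_of (M : 'M[C]_3) : GL3 R := insubd (SigSub GL3_1 : GL3 R) M.

Lemma val_GL_of M : M \in unitmx -> val (GL_of M) = M.
Proof. by move=> MU; rewrite insubdK// unfold_in; apply/mem_set. Qed.

(** The determinant stays nonzero near [x], so the junk value does not occur there. *)
Lemma cvg_GL_of (X : topologicalType) (f : X -> 'M[C]_3) x :
  f x \in unitmx -> (forall i j, f y i j @[y --> x] --> f x i j) ->
  GL_of (f y) @[y --> x] --> GL_of (f x).
Proof.
move=> fU cf W nW; rewrite nbhsE in nW; case: nW => _ [[B oB <-] /= Bx] BW.
rewrite set_valE /= val_GL_of// in Bx.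
have dU : \forall y \near x, \det (f y) != 0.
  have fx0 : \det (f x) != 0 by rewrite -unitfE -unitmxE.
  exact: (cvgr_neq0 _ (cvg_det cf) fx0).
have nB : \forall y \near x, B (f y).
  by apply: (cvg_mx cf); exact: open_nbhs_nbhs.
suff nW : \forall y \near x, W (GL_of (f y)) by exact: nW.
have /filterI/(_ nB) := dU; apply: filterS => y [/= dy By]; apply: BW => /=.
by rewrite set_valE /= val_GL_of// unitmxE unitfE.
Qed.

End LocalLifts.

(** * The orbit map and its continuous inverse *)

Section OrbitMap.
Variable R : realType.
Local Notation C := (Cplx R).

(** Arbitrary lifts are allowed, so that chosen representatives and local continuous lifts can be
    compared. *)
Lemma orbit_map_frame (x p : F4 R) v w :
  is_lift (val p) v -> is_lift (val x) w ->
  orbit_map x (proj_class (GL_of (frame v *m invmx (frame w)))) = p.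
Proof.
move=> pv xw; have gv := F4_general_position pv.
have gw := F4_general_position xw.
apply: val_inj; apply/funext => i /=.
have [u uv <-] := pv i; have [t tw <-] := xw i.
rewrite PGL3_act_class; apply/esym/proj_classP.
exists (frame_coef v i / frame_coef w i).
  by rewrite mulf_neq0 ?invr_eq0// frame_coef_neq0.
rewrite /= val_GL_of ?unitmx_mul ?unitmx_inv ?frame_unit// tw uv.
by rewrite frame_quotient.
Qed.

Lemma orbit_map_inj (x : F4 R) : injective (orbit_map x).
Proof.
move=> g h; have [{}g ->] := proj_class_surj g.
have [{}h ->] := proj_class_surj h => gh.
have gx := F4_general_position (repr_liftP x).
have hU := set_valP h.
have /choice[c cP] i : exists c, c != 0 /\
    val g *m repr_lift x i = c *: (val h *m repr_lift x i).
  have /(congr1 val)/(congr1 (@^~ i)) /= := gh.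
  have [u <- <-] := repr_liftP x i; rewrite !PGL3_act_class.
  by move=> /esym/proj_classP[c c0 e]; exists c; split.
apply/esym/proj_classP; exists (c ord_max); first exact: (cP _).1.
exact: general_position_proportional gx hU (fun i => (cP i).2).
Qed.

Definition orbit_inv (x p : F4 R) : PGL3 R :=
  proj_class (GL_of (frame (repr_lift p) *m invmx (frame (repr_lift x)))).

Lemma orbit_invK x : cancel (orbit_inv x) (orbit_map x).
Proof. by move=> p; apply: orbit_map_frame; exact: repr_liftP. Qed.

Lemma orbit_mapK x : cancel (orbit_map x) (orbit_inv x).
Proof. by move=> g; apply: (@orbit_map_inj x); rewrite orbit_invK. Qed.

(** The representatives in [orbit_inv] need not vary continuously. Near [y] they are replaced by
    chart lifts, which give the same class because the orbit map is injective. *)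
Lemma orbit_inv_comp_continuous (X : topologicalType) (x : F4 R)
    (q : X -> F4 R) :
  (forall i, continuous (fun y => val (q y) i)) ->
  continuous (orbit_inv x \o q).
Proof.
move=> cq y.
(* Choose for each of the four points a chart that contains it. *)
have /choice[k kP] i : exists k, repr_lift (q y) i k 0 != 0.
  by apply/cV0Pn; exact: (set_valP (proj_repr (val (q y) i))).
pose v z i := lift_at (k i) (val (q z) i).
have vP : \forall z \near y, is_lift (val (q z)) (v z).
  apply: filter_forall => i.
  have := lift_at_near (kP i); rewrite proj_reprK => n.
  exact: (cq i y _ n).
have cv i j : v z i j 0 @[z --> y] --> v y i j 0.
  have := @cvg_lift_at _ _ _ j (kP i); rewrite proj_reprK.
  exact: cvg_comp (cq i y).
pose M z := frame (v z) *m invmx (frame (repr_lift x)).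
have ME z : is_lift (val (q z)) (v z) ->
    proj_class (GL_of (M z)) = orbit_inv x (q z).
  move=> zv; apply: (@orbit_map_inj x).
  by rewrite [RHS]orbit_invK; apply: orbit_map_frame => //; exact: repr_liftP.
have vy : is_lift (val (q y)) (v y) := nbhs_singleton vP.
suff cM : GL_of (M z) @[z --> y] --> GL_of (M y).
  move=> W nW.
  have {}nW : nbhs (proj_class (GL_of (M y))) W by rewrite (ME y vy).
  have nM : \forall z \near y, W (proj_class (GL_of (M z))).
    exact: (cM _ (@proj_class_continuous _ _ _ _ (GL_of (M y)) _ nW)).
  suff nq : \forall z \near y, W (orbit_inv x (q z)) by exact: nq.
  by have /filterI/(_ nM) := vP; apply: filterS => z [/ME <-].
apply: cvg_GL_of => [|i j].
  rewrite unitmx_mul unitmx_inv !frame_unit//.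
    exact: F4_general_position (repr_liftP x).
  exact: F4_general_position vy.
rewrite mxE; under eq_cvg => z do rewrite mxE.
apply: cvg_big => [|a _]; first exact: add_continuous.
apply: cvgMr_tmp; exact: cvg_frame.
Qed.

Lemma orbit_inv_continuous (x : F4 R) : continuous (orbit_inv x).
Proof.
apply: (@orbit_inv_comp_continuous _ x id) => i p.
apply: (@continuous_comp _ _ _ set_val (fun p : {ptws 'I_4 -> CP2 R} => p i)).
  exact: set_val_continuous.
exact: ptws_continuous.
Qed.

HB.instance Definition _ x :=
  isContinuous.Build _ _ (orbit_inv x) (@orbit_inv_continuous x).

End OrbitMap.

(** * Paths in the general linear group *)

(** Turns avoiding singular matrices on the line from [h] to 1 into avoiding the roots of a
    polynomial. *)
Lemma det_line_poly (F : fieldType) n (h : 'M[F]_n) :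
  exists p : {poly F}, forall z, p.[z] = \det ((1 - z) *: h + z%:M).
Proof.
exists (\det ((1 - 'X) *: map_mx polyC h + 'X%:M)) => z.
rewrite -[LHS]/(horner_eval z _) -det_map_mx; congr (\det _).
apply/matrixP => i j; rewrite !mxE /= /horner_eval.
by rewrite !hornerE hornerMn hornerX.
Qed.

Lemma continuous_segment (K : numFieldType) (X : topologicalType) (f : X -> K)
    (a b : K) :
  continuous f -> continuous (fun x => (1 - f x) * a + f x * b).
Proof.
move=> cf x; apply: cvgD; apply: cvgMr_tmp; last exact: cf.
by apply: cvgB; [exact: cvg_cst|exact: cf].
Qed.

Section Paths.
Variable R : realType.
Local Notation C := (Cplx R).

Lemma real_complex_continuous : continuous (fun t : R => (t%:C)%C : C).
Proof.
move=> t; apply/cvgrPdist_lt => e e0.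
(* In the order on the complex numbers, a positive [e] is real. *)
have [er ei] : 0 < complex.Re e /\ complex.Im e = 0.
  by move: e0; case: e => a b; rewrite ltcE /= => /andP[/eqP -> ->].
have near_t : \forall u \near t, `|t - u| < complex.Re e.
  exact: (nbhsx_ballx t _ er).
apply: filterS near_t => u tu.
rewrite -rmorphB normc_def /= expr0n /= addr0 sqrtr_sqr.
by case: e er ei e0 tu => a b /= _ -> _ tu; rewrite ltcR.
Qed.

(* For [c != 0] the arc is real only at [0] and [1], and each other point of
   the plane lies on at most one arc. *)
Definition arc (c t : R) : C := (t +i* (c * (t * (1 - t))))%C.

Lemma arc0 c : arc c 0 = 0.
Proof. by rewrite /arc mul0r mulr0. Qed.

Lemma arc1 c : arc c 1 = 1.
Proof. by rewrite /arc subrr !mulr0. Qed.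

Lemma arc_continuous c : continuous (arc c).
Proof.
have -> : arc c = fun t : R =>
    (t%:C)%C + 'i%C * ((c * (t * (1 - t)))%:C)%C :> C.
  by apply/funext => t; rewrite /arc; simpc.
move=> t; apply: (@cvgD C C); first exact: real_complex_continuous.
apply: (@cvgMl_tmp C).
apply: (@continuous_comp _ _ _ (fun t : R => c * (t * (1 - t)))
  (fun t : R => (t%:C)%C : C)); last exact: real_complex_continuous.
apply: cvgMl_tmp; apply: cvgM; first exact: cvg_id.
by apply: cvgB; [exact: cvg_cst|exact: cvg_id].
Qed.

Lemma arc_avoids_roots (p : {poly C}) : p.[0] != 0 -> p.[1] != 0 ->
  exists c, forall t, p.[arc c t] != 0.
Proof.
move=> p0 p1; have [rs prs] := closed_field_poly_normal p.
(* The only parameter whose arc can pass through [z] when its real part is neither 0 nor 1. The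
   value of [c] chosen next exceeds the slopes of all roots. *)
pose slope (z : C) := complex.Im z / (complex.Re z * (1 - complex.Re z)).
exists (1 + \sum_(z <- rs) `|slope z|) => t.
set c := (1 + _); apply/negP => rt.
have zrs : arc c t \in rs.
  have : root p (arc c t) by [].
  rewrite prs rootZ ?root_prod_XsubC// lead_coef_eq0.
  by apply: contra_neq p0 => ->; rewrite horner0.
have t0 : t * (1 - t) != 0.
  rewrite mulf_eq0 subr_eq0 negb_or; apply/andP; split.
    by apply: contraTneq rt => ->; rewrite arc0.
  by apply: contraTneq rt => <-; rewrite arc1.
have sc : slope (arc c t) = c by rewrite /slope /= mulfK.
have : `|slope (arc c t)| <= \sum_(z <- rs) `|slope z|.
  by rewrite (big_rem _ zrs) /= lerDl sumr_ge0.
apply/negP; rewrite sc -ltNge.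
apply: (@lt_le_trans _ _ c); first by rewrite /c ltrDr.
exact: ler_norm.
Qed.

Lemma GL3_path (h : GL3 R) : exists g : R -> GL3 R,
  [/\ continuous g, g 0 = h & val (g 1) = 1%:M].
Proof.
have [p pE] := det_line_poly (val h).
have [||c cP] := @arc_avoids_roots p.
- rewrite pE subr0 scale1r raddf0 addr0 -unitfE -unitmxE; exact: set_valP h.
- by rewrite pE subrr scale0r add0r det1 oner_eq0.
have gU t : (1 - arc c t) *: val h + (arc c t)%:M \in GL3 R.
  by apply/mem_set; rewrite /GL3 /= unitmxE unitfE -pE.
exists (fun t => SigSub (gU t)); split.
- apply: continuous_to_set; apply: continuous_mx => i j.
  rewrite (_ : (fun _ => _) = fun t : R =>
      (1 - arc c t) * val h i j + arc c t * (i == j)%:R); last first.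
    by apply/funext => t; rewrite /= set_valE /= !mxE mulr_natr.
  by apply: continuous_segment; exact: arc_continuous.
- by apply: val_inj; rewrite /= arc0 subr0 scale1r raddf0 addr0.
- by rewrite /= arc1 subrr scale0r add0r.
Qed.

End Paths.

(** * The homotopy from a permutation to the identity *)

Section Homotopy.
Variable R : realType.

Lemma S4_act_diag_act (s : 'S_4) (g : PGL3 R) (p : F4 R) :
  S4_act s (diag_act g p) = diag_act g (S4_act s p).
Proof. exact: val_inj. Qed.

Lemma diag_act1 (g : GL3 R) (p : F4 R) :
  val g = 1%:M -> diag_act (proj_class g) p = p.
Proof.
move=> g1; apply: val_inj; apply/funext => i /=.
have [u ->] := proj_class_surj (val p i); rewrite PGL3_act_class.
by congr proj_class; apply: val_inj; rewrite /= g1 mul1mx.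
Qed.

Lemma S4_act_homotopic_id (s : 'S_4) : homotopic R (@S4_act R s) idfun.
Proof.
(* If there is no basepoint, the endpoint condition at 0 is vacuous, so no explicit frame has to be
   exhibited. *)
have [[x _]|F4empty] := pselect (exists x : F4 R, True); last first.
  exists snd; split => [|p|p]; last by [].
    by apply: continuous_subspaceT => z; exact: cvg_snd.
  by case: F4empty; exists p.
have [h hE] := proj_class_surj (orbit_inv x (S4_act s x)).
have [g [cg g0 g1]] := GL3_path h.
(* Write p = k x with k = [orbit_inv x p]; the homotopy sends p to k g(t) x. At t = 0 this is k (s
   x) = s (k x) = s p, since the two actions commute. *)
pose H (z : R * F4 R) :=
  diag_act (orbit_inv x z.2) (diag_act (proj_class (g z.1)) x).
exists H; split => [|p|p].
- apply: continuous_subspaceT; apply: diag_act_continuous => [z|].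
    apply: (@continuous_comp _ _ _ snd (orbit_inv x)); first exact: cvg_snd.
    exact: orbit_inv_continuous.
  apply: diag_act_continuous => [z|z]; last exact: cst_continuous.
  apply: (@continuous_comp _ _ _ (g \o fst) (@proj_class _ _ _ _)); last first.
    exact: proj_class_continuous.
  by apply: (@continuous_comp _ _ _ fst g); [exact: cvg_fst|exact: cg].
- rewrite /H /= g0 -hE -[diag_act _ x]/(orbit_map x _) orbit_invK.
  by rewrite -S4_act_diag_act -[diag_act _ x]/(orbit_map x _) orbit_invK.
- by rewrite /H /= diag_act1// -[LHS]/(orbit_map x _) orbit_invK.
Qed.

End Homotopy.

Theorem proposition2p5 (R : realType) :
  [/\ forall s : 'S_4, homotopic R (@S4_act R s) idfun,
      forall (x : F4 R) (n : nat),
        bijective (cohomology_map (orbit_map x) :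
          {linear cohomology R (F4 R) n -> cohomology R (PGL3 R) n})
    & forall (n : nat) (s : 'S_4) (a : cohomology R (F4 R) n),
        S4_cohomology_act s a = a].
Proof.
split => [s|x n|n s a]; first exact: S4_act_homotopic_id.
  exists (cohomology_map (orbit_inv x)); apply: cohomology_map_cancel.
    exact: orbit_invK.
  exact: orbit_mapK.
rewrite -[RHS]cohomology_map_id; apply: homotopic_cohomology_map.
exact: S4_act_homotopic_id.
Qed.
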